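(* Let $\mathbb{U}$ be a Euclidean space, let $\mathcal{M}\subset\mathbb{U}$ be a $C^{(2)}$-smooth manifold around a point $u\in\mathcal{M}$, and let $v\in N_{\mathcal{M}}(u)$. Then the normal mapping $N_{\mathcal{M}}\colon\mathbb{U}\rightrightarrows\mathbb{U}$ satisfies the derivative-coderivative equality $$DN_{\mathcal{M}}(u\,|\,v)=D^*N_{\mathcal{M}}(u\,|\,v).$$
   Context: A $C^{(2)}$-manifold around $u$ is a set that near $u$ equals the common zero set of $C^{(2)}$ functions $h_1,\dots,h_m$ with linearly independent gradients at $u$. $N_{\mathcal{M}}$ is the set-valued mapping sending $x\in\mathcal{M}$ (near $u$) to the classical normal space $N_{\mathcal{M}}(x)$ and points outside $\mathcal{M}$ to the empty set. For a set-valued mapping $\Phi$ and $(x,y)\in\mathrm{gph}\,\Phi$, the graphical derivative is defined by $z\in D\Phi(x\,|\,y)(w)\iff(w,z)\in T_{\mathrm{gph}\,\Phi}(x,y)$ (tangent cone to the graph), and the coderivative by $z\in D^*\Phi(x\,|\,y)(w)\iff(z,-w)\in N_{\mathrm{gph}\,\Phi}(x,y)$ (limiting normal cone to the graph). *)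

(* Defs.v *)
From HB Require Import structures.
From mathcomp Require Import all_boot all_order all_algebra.
From mathcomp Require Import all_classical all_reals all_analysis.
Set Implicit Arguments. Unset Strict Implicit. Unset Printing Implicit Defensive.
Import Order.TTheory GRing.Theory Num.Theory.
Import numFieldNormedType.Exports.
Local Open Scope classical_set_scope.
Local Open Scope ring_scope.

Section Defs.
Variable R : realType.

Definition dotv (N : nat) (a b : 'rV[R]_N) : R := (a *m b^T) 0 0.

Definition ebasis (n : nat) (i : 'I_n) : 'rV[R]_n := delta_mx 0 i.

Definition grad (n : nat) (f : 'rV[R]_n -> R) (x : 'rV[R]_n) : 'rV[R]_n :=
  \row_i 'D_(ebasis i) f x.

Definition C2_on (n : nat) (O : set 'rV[R]_n) (f : 'rV[R]_n -> R) : Prop :=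
  forall x, O x ->
    {for x, continuous f} /\
    (forall i, derivable f x (ebasis i) /\ {for x, continuous ('D_(ebasis i) f)}) /\
    (forall i j, derivable ('D_(ebasis i) f) x (ebasis j) /\
                 {for x, continuous ('D_(ebasis j) ('D_(ebasis i) f))}).

Definition C2_manifold_around (n : nat) (M : set 'rV[R]_n) (u : 'rV[R]_n) : Prop :=
  exists (m : nat) (h : 'I_m -> 'rV[R]_n -> R) (O : set 'rV[R]_n),
    [/\ open O, O u,
        (forall k, C2_on O (h k)),
        row_free (\matrix_(k < m) grad (h k) u) &
        M `&` O = [set x | O x /\ forall k, h k x = 0]].

Definition tangent_cone (N : nat) (S : set 'rV[R]_N) (x : 'rV[R]_N) : set 'rV[R]_N :=
  [set w | exists (t : nat -> R) (wk : nat -> 'rV[R]_N),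
     [/\ (forall k, 0 < t k), t @ \oo --> 0, wk @ \oo --> w &
         forall k, S (x + t k *: wk k)]].

Definition regular_normal (N : nat) (S : set 'rV[R]_N) (x : 'rV[R]_N) : set 'rV[R]_N :=
  [set v | S x /\ forall eps : R, 0 < eps ->
     \forall y \near x, S y -> dotv v (y - x) <= eps * `|y - x|].

Definition limiting_normal (N : nat) (S : set 'rV[R]_N) (x : 'rV[R]_N) : set 'rV[R]_N :=
  [set v | S x /\ exists (y vk : nat -> 'rV[R]_N),
     [/\ y @ \oo --> x, vk @ \oo --> v, (forall k, S (y k)) &
         forall k, regular_normal S (y k) (vk k)]].

(* Classical normal space: orthogonal complement of the tangent space
   (= tangent cone) of M at x, for x in M; empty outside M. *)
Definition normal_map (n : nat) (M : set 'rV[R]_n) (x : 'rV[R]_n) : set 'rV[R]_n :=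
  [set v | M x /\ forall w, tangent_cone M x w -> dotv v w = 0].

Definition gph (n : nat) (Phi : 'rV[R]_n -> set 'rV[R]_n) : set 'rV[R]_(n + n) :=
  [set p | exists x y, p = row_mx x y /\ Phi x y].

Definition graph_deriv (n : nat) (Phi : 'rV[R]_n -> set 'rV[R]_n) (x y : 'rV[R]_n)
  : 'rV[R]_n -> set 'rV[R]_n :=
  fun w => [set z | tangent_cone (gph Phi) (row_mx x y) (row_mx w z)].

Definition coderiv (n : nat) (Phi : 'rV[R]_n -> set 'rV[R]_n) (x y : 'rV[R]_n)
  : 'rV[R]_n -> set 'rV[R]_n :=
  fun w => [set z | limiting_normal (gph Phi) (row_mx x y) (row_mx z (- w))].

End Defs.

(* Main.v *)
(** Near [u] the graph of [N_M] consists of the pairs [(x, l J(x))] with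
    [h x = 0], where [J] is the Jacobian of [h] and [l] a multiplier.  With
    [v = l J(u)] and [H = sum_k l_k Hess h_k (u)], its tangent cone at [(u, v)]
    is the subspace of all [(w, z)] with [J(u) w = 0] and [z - H w] in the row
    space of [J(u)].  The limiting normal cone is the polar of that subspace:
    regular normals at nearby points of the graph are polar to tangent spaces of
    the same form, which vary continuously.  Since [H] is symmetric, the linear
    map [(w, z) |-> (z, -w)] carries the subspace onto its polar. *)
From HB Require Import structures.
Require Import Defs.
From mathcomp Require Import all_boot all_order all_algebra.
From mathcomp Require Import all_classical all_reals all_analysis.
From mathcomp Require Import ring.
Set Implicit Arguments. Unset Strict Implicit. Unset Printing Implicit Defensive.
Import Order.TTheory GRing.Theory Num.Theory.
Import numFieldNormedType.Exports.
Local Open Scope classical_set_scope.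
Local Open Scope ring_scope.

(** * Limits of matrix-valued functions: entries, products, determinants, inverses *)

Section MatrixLimits.
Variable R : realType.

Lemma mx_norm_le (m n : nat) (A : 'M[R]_(m, n)) (e : R) :
  0 <= e -> (`|A| <= e) <-> (forall i j, `|A i j| <= e).
Proof.
move=> e0; rewrite {1}/Num.norm /= mx_normrE; split=> [/bigmax_leP[_ H] i j|H].
  exact: (H (i, j)).
by apply/bigmax_leP; split=> // ij _; exact: H.
Qed.

Lemma mx_entry_le_norm (m n : nat) (A : 'M[R]_(m, n)) i j : `|A i j| <= `|A|.
Proof. by move: i j; apply/mx_norm_le. Qed.

(** The norm is the largest absolute value of an entry, and an entry of the product is a sum of [n]
    terms, whence the factor [n]. *)
Lemma norm_mulmx_le (m n p : nat) (A : 'M[R]_(m, n)) (B : 'M[R]_(n, p)) :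
  `|A *m B| <= n%:R * `|A| * `|B|.
Proof.
apply/mx_norm_le => [|i j]; first by rewrite !mulr_ge0.
rewrite mxE (le_trans (ler_norm_sum _ _ _))//.
apply: (@le_trans _ _ (\sum_(k < n) `|A| * `|B|)).
  by apply: ler_sum => k _; rewrite normrM ler_pM// mx_entry_le_norm.
by rewrite sumr_const card_ord -mulrA mulr_natl.
Qed.

Section Filter.
Context {T : Type} {F : set_system T} {FF : Filter F}.

Lemma cvg_mxP (m n : nat) (A : T -> 'M[R]_(m, n)) (a : 'M[R]_(m, n)) :
  (A @ F --> a) <-> (forall i j, (fun t => A t i j) @ F --> a i j).
Proof.
split=> [Aa i j|Aa].
  exact: (cvg_comp _ _ Aa (@coord_continuous R m n i j a)).
apply/cvgrPdist_le => e e0.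
have : \forall t \near F, forall ij : 'I_m * 'I_n,
    `|a ij.1 ij.2 - A t ij.1 ij.2| <= e.
  apply: filter_forall => -[i j] /=.
  by move/cvgrPdist_le: (Aa i j); exact.
apply: filterS => t H; apply/mx_norm_le; first exact: ltW.
by move=> i j; rewrite !mxE; exact: (H (i, j)).
Qed.

Lemma cvg_mulmx (m n p : nat) (A : T -> 'M[R]_(m, n)) (B : T -> 'M[R]_(n, p))
    (a : 'M[R]_(m, n)) (b : 'M[R]_(n, p)) :
  A @ F --> a -> B @ F --> b -> (fun t => A t *m B t) @ F --> a *m b.
Proof.
move=> /cvg_mxP Aa /cvg_mxP Bb; apply/cvg_mxP => i j.
rewrite mxE; under eq_fun do rewrite mxE.
apply: cvg_big; first exact: add_continuous.
by move=> k _; apply: cvgM; [exact: Aa|exact: Bb].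
Qed.

Lemma cvg_trmx (m n : nat) (A : T -> 'M[R]_(m, n)) (a : 'M[R]_(m, n)) :
  A @ F --> a -> (fun t => (A t)^T) @ F --> a^T.
Proof.
move=> /cvg_mxP Aa; apply/cvg_mxP => i j; rewrite mxE.
by under eq_fun do rewrite mxE; exact: Aa.
Qed.

Lemma cvg_row_mx (m n p : nat) (A : T -> 'M[R]_(m, n)) (B : T -> 'M[R]_(m, p))
    (a : 'M[R]_(m, n)) (b : 'M[R]_(m, p)) :
  ((fun t => row_mx (A t) (B t)) @ F --> row_mx a b) <->
  (A @ F --> a) /\ (B @ F --> b).
Proof.
split=> [/cvg_mxP C|[/cvg_mxP Aa /cvg_mxP Bb]].
  split; apply/cvg_mxP => i j.
    have := C i (lshift p j); rewrite row_mxEl.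
    by under eq_fun do rewrite row_mxEl.
  have := C i (rshift n j); rewrite row_mxEr.
  by under eq_fun do rewrite row_mxEr.
apply/cvg_mxP => i j; case: (split_ordP j) => k ->.
  by rewrite row_mxEl; under eq_fun do rewrite row_mxEl; exact: Aa.
by rewrite row_mxEr; under eq_fun do rewrite row_mxEr; exact: Bb.
Qed.

Lemma cvg_det (n : nat) (A : T -> 'M[R]_n) (a : 'M[R]_n) :
  A @ F --> a -> (fun t => \det (A t)) @ F --> \det a.
Proof.
move=> /cvg_mxP Aa; rewrite /determinant.
apply: cvg_big; first exact: add_continuous.
move=> s _; apply: cvgM; first exact: cvg_cst.
by apply: cvg_big => [|i _]; [exact: mul_continuous|exact: Aa].
Qed.

Lemma cvg_unitmx (n : nat) (A : T -> 'M[R]_n) (a : 'M[R]_n) :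
  A @ F --> a -> a \in unitmx -> \forall t \near F, A t \in unitmx.
Proof.
move=> /cvg_det Aa; rewrite unitmxE unitfE => a0.

near=> t.
by rewrite unitmxE unitfE; near: t; exact: (cvgr_neq0 _ Aa a0).
Unshelve. all: by end_near.
Qed.

Lemma cvg_invmx (n : nat) (A : T -> 'M[R]_n) (a : 'M[R]_n) :
  A @ F --> a -> a \in unitmx -> (fun t => invmx (A t)) @ F --> invmx a.
Proof.
move=> Aa ua; have dA := cvg_det Aa.
have adA : (fun t => \adj (A t)) @ F --> \adj a.
  apply/cvg_mxP => i j; rewrite mxE; under eq_fun do rewrite mxE.
  rewrite /cofactor; apply: cvgM; first exact: cvg_cst.
  apply: cvg_det; apply/cvg_mxP => k l; rewrite !mxE.
  under eq_fun do rewrite !mxE.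
  by move/cvg_mxP: Aa; exact.
have -> : invmx a = (\det a)^-1 *: \adj a by rewrite /invmx ua.
have C : (fun t => (\det (A t))^-1 *: \adj (A t)) @ F --> (\det a)^-1 *: \adj a.
  apply: cvgZ => //; apply: cvgV => //.
  by move: ua; rewrite unitmxE unitfE.
(* [invmx] returns its argument unchanged off the unit matrices, so the adjugate formula for
   [invmx (A t)] holds only eventually. *)
apply: cvg_trans C; apply: near_eq_cvg.
near=> t; have ut : A t \in unitmx by near: t; exact: cvg_unitmx Aa ua.
by rewrite /invmx ut.
Unshelve. all: by end_near.
Qed.

End Filter.
End MatrixLimits.

(** * Strict differentiability of C1 maps and symmetry of second partial derivatives *)

Section StrictDifferentiability.
Variable R : realType.

Lemma dotvE (n : nat) (a b : 'rV[R]_n) : dotv a b = \sum_i a 0 i * b 0 i.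
Proof. by rewrite /dotv mxE; apply: eq_bigr => i _; rewrite mxE. Qed.

Lemma is_derive_line (n : nat) (f : 'rV[R]_n -> R) (c e : 'rV[R]_n) (s : R) :
  derivable f (c + s *: e) e ->
  is_derive s 1 (fun t => f (c + t *: e)) ('D_e f (c + s *: e)).
Proof.
move=> df.
have E : (fun h => h^-1 *:
      (((fun t => f (c + t *: e)) \o shift s) (h *: (1 : R)) - f (c + s *: e))) =
    (fun h => h^-1 *: ((f \o shift (c + s *: e)) (h *: e) - f (c + s *: e))).
  apply/funext => h /=; congr (_ *: (f _ - _)).
  by rewrite [h *: 1]mulr1 scalerDl addrCA.
split; first by rewrite /derivable E; exact: df.
by rewrite {1}/derive E.
Qed.

(** Parametrising the segment from [c] to [c + d *: e] by [[0, 1]] avoids a case split on the sign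
    of [d] and covers [d = 0]. *)
Lemma partial_MVT (n : nat) (f : 'rV[R]_n -> R) (c e : 'rV[R]_n) (d : R) :
  (forall s : R, 0 <= s <= 1 -> derivable f (c + (s * d) *: e) e) ->
  exists2 s : R, 0 <= s <= 1 & f (c + d *: e) - f c = 'D_e f (c + (s * d) *: e) * d.
Proof.
move=> df; pose g (s : R) := f (c + (s * d) *: e).
have gd (s : R) : 0 <= s <= 1 -> is_derive s 1 g ('D_e f (c + (s * d) *: e) * d).
  move=> s01; apply: (@is_derive1_comp _ (fun t => f (c + t *: e)) (fun t => t * d)).
    by apply: is_derive_line; exact: df.
  have -> : (fun t => t * d) = (d \*: id) by apply/funext => t /=; rewrite mulrC.
  by apply: is_derive_eq; rewrite [_ *: _]mulr1.
have [||s s01] := @MVT_segment R g (fun s => 'D_e f (c + (s * d) *: e) * d) 0 1 ler01.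
- by move=> s; rewrite in_itv /= => /andP[s0 s1]; apply: gd; rewrite !ltW.
- apply: derivable_within_continuous => s; rewrite in_itv /= => s01.
  by have [] := gd _ s01.
- rewrite /g mul1r mul0r scale0r addr0 subr0 mulr1 => E.
  by exists s; rewrite -?E//; move: s01; rewrite in_itv.
Qed.

(* The points on the staircase from [b] to [a] that changes one coordinate at a
   time; it stays in every sup-norm ball containing [a] and [b]. *)
Definition staircase (n : nat) (a b : 'rV[R]_n) (j : nat) : 'rV[R]_n :=
  \row_i if (i < j)%N then a 0 i else b 0 i.

Lemma staircase_succ (n : nat) (a b : 'rV[R]_n) (j : 'I_n) :
  staircase a b j.+1 = staircase a b j + (a 0 j - b 0 j) *: ebasis R j.
Proof.
apply/rowP => i; rewrite !mxE eqxx /= ltnS leq_eqVlt -(inj_eq val_inj) /=.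
have [->|ij] := eqVneq i j; first by rewrite ltnn eqxx mulr1 addrC subrK.
by rewrite (inj_eq val_inj) (negbTE ij) mulr0 addr0.
Qed.

(** Each coordinate of the point is one of [a], one of [b], or a convex combination of the two. *)
Lemma staircase_near (n : nat) (a b x : 'rV[R]_n) (j : 'I_n) (d s : R) :
  `|a - x| <= d -> `|b - x| <= d -> 0 <= s <= 1 ->
  `|staircase a b j + (s * (a 0 j - b 0 j)) *: ebasis R j - x| <= d.
Proof.
move=> ax bx s01; have d0 : 0 <= d by rewrite (le_trans _ ax).
apply/mx_norm_le => // k i; rewrite (ord1 k) !mxE eqxx /=.
have {}ax : `|a 0 i - x 0 i| <= d.
  by apply: le_trans ax; rewrite (le_trans _ (mx_entry_le_norm _ 0 i))// !mxE.
have {}bx : `|b 0 i - x 0 i| <= d.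
  by apply: le_trans bx; rewrite (le_trans _ (mx_entry_le_norm _ 0 i))// !mxE.
case: (eqVneq i j) ax bx => [->|ij] ax bx; last by rewrite mulr0 addr0; case: ifP.
rewrite ltnn mulr1; case/andP: s01 => s0 s1.
have -> : b 0 j + s * (a 0 j - b 0 j) - x 0 j =
  s * (a 0 j - x 0 j) + (1 - s) * (b 0 j - x 0 j) by ring.
have -> : d = s * d + (1 - s) * d by ring.
rewrite (le_trans (ler_normD _ _))// !normrM (ger0_norm s0).
rewrite (@ger0_norm _ (1 - s)) ?subr_ge0//.
by rewrite lerD// ler_wpM2l// subr_ge0.
Qed.

(** Each step of the staircase changes one coordinate, so the mean value theorem turns its increment
    into a partial derivative at a point near [x]; continuity replaces that by the partial
    derivative at [x]. *)
Lemma C1_strict_diff (n : nat) (f : 'rV[R]_n -> R) (x : 'rV[R]_n) :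
  (\forall y \near x, forall i, derivable f y (ebasis R i)) ->
  (forall i, {for x, continuous ('D_(ebasis R i) f)}) ->
  forall e, 0 < e -> \forall p \near (x, x),
    `|f p.1 - f p.2 - dotv (p.1 - p.2) (grad f x)| <= e * `|p.1 - p.2|.
Proof.
(* The error is shared among the [n] coordinates; the successor keeps the denominator nonzero. *)
move=> df cf e e0; pose e' := e / n.+1%:R.
have e'0 : 0 < e' by rewrite divr_gt0.
have : \forall y \near x, (forall i, derivable f y (ebasis R i)) /\
    forall i, `|'D_(ebasis R i) f x - 'D_(ebasis R i) f y| <= e'.
  have H : \forall y \near x, forall i,
      `|'D_(ebasis R i) f x - 'D_(ebasis R i) f y| <= e'.
    apply: (@filter_forall _ _ _ _ (nbhs_filter x)) => i.
    by move/cvgrPdist_le: (cf i); exact.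
  by near=> y; split; near: y.
case/nbhs_ballP => d /= d0 H.
(* [staircase_near] is about closed balls; halving the radius places them inside the open ball. *)
have {}H y : `|y - x| <= d / 2 -> (forall i, derivable f y (ebasis R i)) /\
    forall i, `|'D_(ebasis R i) f x - 'D_(ebasis R i) f y| <= e'.
  move=> yx; apply: H; rewrite mx_norm_ball /ball_ /= distrC (le_lt_trans yx)//.
  by rewrite ltr_pdivrMr// ltr_pMr// ltr1n.
have d20 : 0 < d / 2 by rewrite divr_gt0.
apply/nbhs_ballP; exists (d / 2) => //= -[a b] [] /=.
rewrite mx_norm_ball /ball_ /= => ax bx.
have {}ax : `|a - x| <= d / 2 by rewrite distrC ltW.
have {}bx : `|b - x| <= d / 2 by rewrite distrC ltW.
pose c := staircase a b.
have -> : f a - f b = \sum_(0 <= j < n) (f (c j.+1) - f (c j)).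
  rewrite telescope_sumr//; congr (f _ - f _); apply/rowP => i; rewrite mxE//.
  by rewrite ltn_ord.
rewrite big_mkord dotvE -sumrB.
apply: (@le_trans _ _ (\sum_(j < n) e' * `|a - b|)).
  rewrite (le_trans (ler_norm_sum _ _ _))//; apply: ler_sum => j _.
  rewrite /c staircase_succ.
  have [|s s01 ->] := @partial_MVT n f (c j) (ebasis R j) (a 0 j - b 0 j).
    by move=> s s01; have [+ _] := H _ (staircase_near j ax bx s01); exact.
  have [_ /(_ j)] := H _ (staircase_near j ax bx s01).
  rewrite !mxE [_ * 'D__ f x]mulrC -mulrBl normrM => h.
  rewrite ler_pM//; first by rewrite distrC.
  by rewrite (le_trans _ (mx_entry_le_norm (a - b) 0 j))// !mxE.
rewrite sumr_const card_ord -mulr_natr -mulrAC ler_wpM2r//.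
by rewrite /e' mulrAC ler_pdivrMr// ler_pM2l// ler_nat.
Unshelve. all: by end_near. Qed.

(** Both points vary near [x]. Row vectors are multiplied on the right, so [A] is the transpose of
    the usual Jacobian matrix. *)
Definition strict_diff (n m : nat) (F : 'rV[R]_n -> 'rV[R]_m) (x : 'rV[R]_n)
    (A : 'M[R]_(n, m)) :=
  forall e, 0 < e -> \forall p \near (x, x),
    `|F p.1 - F p.2 - (p.1 - p.2) *m A| <= e * `|p.1 - p.2|.

Lemma C1_strict_diff_vec (n m : nat) (F : 'rV[R]_n -> 'rV[R]_m) (x : 'rV[R]_n) :
  (forall k, \forall y \near x, forall i,
     derivable (fun y => F y 0 k) y (ebasis R i)) ->
  (forall k i, {for x, continuous ('D_(ebasis R i) (fun y => F y 0 k))}) ->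
  strict_diff F x (\matrix_k grad (fun y => F y 0 k) x)^T.
Proof.
move=> dF cF e e0.
have : \forall p \near (x, x), forall k : 'I_m,
    `|F p.1 0 k - F p.2 0 k - dotv (p.1 - p.2) (grad (fun y => F y 0 k) x)|
      <= e * `|p.1 - p.2|.
  apply: (@filter_forall _ _ _ _ (nbhs_filter (x, x))) => k.
  exact: C1_strict_diff.
apply: filterS => p H; apply/mx_norm_le => [|i k].
  by rewrite mulr_ge0// ltW.
rewrite (ord1 i); apply: le_trans (H k); rewrite dotvE !mxE.
rewrite (eq_bigr (fun j => (p.1 - p.2) 0 j * grad (fun y => F y 0 k) x 0 j))//.
by move=> j _; rewrite !mxE.
Qed.

Lemma strict_diff_ball (n m : nat) (F : 'rV[R]_n -> 'rV[R]_m) x A e :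
  strict_diff F x A -> 0 < e -> exists2 d, 0 < d & forall a b,
    `|a - x| < d -> `|b - x| < d -> `|F a - F b - (a - b) *m A| <= e * `|a - b|.
Proof.
move=> dF e0; have /nbhs_ballP[d /= d0 H] := dF _ e0.
exists d => // a b ax bx; apply: (H (a, b)).
by split; rewrite /= mx_norm_ball /ball_ /= distrC.
Qed.

Lemma cvg_tangent (n : nat) (x w : 'rV[R]_n) (t : nat -> R) (wk : nat -> 'rV[R]_n) :
  t @ \oo --> 0 -> wk @ \oo --> w -> (fun k => x + t k *: wk k) @ \oo --> x.
Proof.
move=> tc wc; rewrite -[X in _ --> X]addr0 -(scale0r w).
by apply: cvgD; [exact: cvg_cst|exact: cvgZ].
Qed.

(** With the second point frozen at [x], the error is at most [e'] times the length of [t k *: w k];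
    dividing by [t k] leaves a small quantity because the [w k] are eventually bounded by
    [|w0| + 1]. *)
Lemma strict_diff_seq (n m : nat) (F : 'rV[R]_n -> 'rV[R]_m) x A
    (t : nat -> R) (w : nat -> 'rV[R]_n) (w0 : 'rV[R]_n) :
  strict_diff F x A -> (forall k, 0 < t k) ->
  t @ \oo --> 0 -> w @ \oo --> w0 ->
  (fun k => (t k)^-1 *: (F (x + t k *: w k) - F x)) @ \oo --> w0 *m A.
Proof.
move=> dF t0 tc wc.
have xc := cvg_tangent (x := x) tc wc.
pose u k := (t k)^-1 *: (F (x + t k *: w k) - F x).
suff Z : (fun k => u k - w k *m A) @ \oo --> (0 : 'rV[R]_m).
  rewrite -[X in X @ _]/u (_ : u = (fun k => (u k - w k *m A) + w k *m A)); last first.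
    by apply/funext => k; rewrite subrK.
  by rewrite -[w0 *m A]add0r; apply: cvgD Z (cvg_mulmx wc (cvg_cst A)).
rewrite /u; apply/cvgrPdist_le => e e0.
have bw : \forall k \near \oo, `|w k| <= `|w0| + 1.
  have /cvgrPdist_le/(_ _ ltr01) := wc; apply: filterS => k h.
  by rewrite -[w k](subrK w0) addrC (le_trans (ler_normD _ _))// lerD2l distrC.
pose e' := e / (`|w0| + 1).
have e'0 : 0 < e' by rewrite divr_gt0// ltr_wpDl.
have [d d0 H] := strict_diff_ball dF e'0.
near=> k; rewrite sub0r normrN.
have xk : x + t k *: w k - x = t k *: w k by rewrite addrC addKr.
have -> : (t k)^-1 *: (F (x + t k *: w k) - F x) - w k *m A =
   (t k)^-1 *: (F (x + t k *: w k) - F x - (x + t k *: w k - x) *m A).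
  rewrite xk [RHS]scalerBr -scalemxAl scalerA.
  by rewrite mulVf ?scale1r// gt_eqF.
rewrite normrZ gtr0_norm ?invr_gt0// ler_pdivrMl//.
have -> : t k * e = e' * (t k * (`|w0| + 1)).
  by rewrite mulrCA /e' divfK// gt_eqF// ltr_wpDl.
apply: le_trans (H _ _ _ _) _.
- by rewrite distrC; near: k; move/cvgrPdist_lt: xc; exact.
- by rewrite subrr normr0.
rewrite xk ler_pM2l// normrZ gtr0_norm//.
by rewrite ler_pM2l//; near: k; exact: bw.
Unshelve. all: by end_near. Qed.

Lemma is_derive_shift (n : nat) (f : 'rV[R]_n -> R) (v y e : 'rV[R]_n) :
  derivable f (y + v) e -> is_derive y e (fun z => f (z + v)) ('D_e f (y + v)).
Proof.
move=> df.
have E : (fun h : R => h^-1 *: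
      (((fun z => f (z + v)) \o shift y) (h *: e) - f (y + v))) =
    (fun h => h^-1 *: ((f \o shift (y + v)) (h *: e) - f (y + v))).
  by apply/funext => h /=; rewrite addrA.
split; first by rewrite /derivable E; exact: df.
by rewrite {1}/derive E.
Qed.

Lemma norm_ebasis_le (n : nat) (i : 'I_n) : `|ebasis R i| <= 1.
Proof.
by apply/mx_norm_le => // k j; rewrite mxE; case: (_ && _); rewrite ?normr1 ?normr0.
Qed.

(* One application of the mean value theorem to [y |-> f (y + t e_j) - f y],
   followed by strict differentiability of [D_i f]. *)
Lemma second_difference (n : nat) (f : 'rV[R]_n -> R) (x : 'rV[R]_n) (i j : 'I_n) :
  (\forall y \near x, forall i, derivable f y (ebasis R i)) ->
  (\forall y \near x, forall j, derivable ('D_(ebasis R i) f) y (ebasis R j)) ->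
  (forall j, {for x, continuous ('D_(ebasis R j) ('D_(ebasis R i) f))}) ->
  forall e, 0 < e -> exists2 d, 0 < d & forall t, 0 < t < d ->
    `|f (x + t *: ebasis R i + t *: ebasis R j) - f (x + t *: ebasis R i)
      - (f (x + t *: ebasis R j) - f x)
      - t ^+ 2 * 'D_(ebasis R j) ('D_(ebasis R i) f) x| <= e * t ^+ 2.
Proof.
move=> /nbhs_ballP[d1 /= d10 df] ddf cf e e0.
have /nbhs_ballP[d2 /= d20 H] := C1_strict_diff ddf cf e0.
set ei := ebasis R i; set ej := ebasis R j.
(* The points used below lie within [t * 2] of [x], hence the halved radius. *)
exists (Num.min d1 d2 / 2); first by rewrite divr_gt0// lt_min d10.
move=> t /andP[t0]; rewrite ltr_pdivlMr// lt_min => /andP[td1 td2].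
have near_x (s r : R) : 0 <= s <= 1 -> 0 <= r <= 1 ->
    `|x - (x + (s * t) *: ei + (r * t) *: ej)| <= t * 2.
  move=> /andP[s0 s1] /andP[r0 r1].
  rewrite -addrA opprD addNKr normrN (le_trans (ler_normD _ _))// !normrZ.
  rewrite !ger0_norm ?mulr_ge0 ?(ltW t0)//.
  have := norm_ebasis_le i; have := norm_ebasis_le j.
  rewrite -/ei -/ej; have := normr_ge0 ei; have := normr_ge0 ej.
  move: `|ei| `|ej| => p q p0 q0 p1 q1.
  by rewrite mulr_natr mulr2n lerD// -[leRHS]mulr1 ler_pM ?mulr_ge0 ?(ltW t0)//
    -[leRHS]mul1r ler_wpM2r ?(ltW t0).
have dfx (s r : R) : 0 <= s <= 1 -> 0 <= r <= 1 ->
    derivable f (x + (s * t) *: ei + (r * t) *: ej) ei.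
  move=> s01 r01; apply: df; rewrite mx_norm_ball /ball_ /=.
  exact: le_lt_trans (near_x _ _ s01 r01) td1.
have i01 (r : R) : r = 1 -> 0 <= r <= 1 by move=> ->; rewrite ler01 lexx.
have o01 (r : R) : r = 0 -> 0 <= r <= 1 by move=> ->; rewrite ler01 lexx.
pose phi y := f (y + t *: ej) - f y.
have dphi (s : R) : 0 <= s <= 1 -> is_derive (x + (s * t) *: ei) ei phi
    ('D_ei f (x + (s * t) *: ei + t *: ej) - 'D_ei f (x + (s * t) *: ei)).
  move=> s01; apply: is_deriveB.
    by apply: is_derive_shift; have := dfx s 1 s01 (i01 _ erefl); rewrite mul1r.
  by apply: DeriveDef => //; have := dfx s 0 s01 (o01 _ erefl); rewrite mul0r scale0r addr0.
have [s s01|s s01] := @partial_MVT n phi x ei t.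
  by have [] := dphi s s01.
have [_ ->] := dphi s s01; rewrite /phi => ->.
have dd : dotv (t *: ej) (grad ('D_ei f) x) = t * 'D_ej ('D_ei f) x.
  rewrite dotvE (bigD1 j)//= big1 ?addr0 => [|k kj].
    by rewrite !mxE !eqxx mulr1.
  by rewrite !mxE (negbTE kj) andbF mulr0 mul0r.
have := H (x + (s * t) *: ei + t *: ej, x + (s * t) *: ei) _.
have -> : x + (s * t) *: ei + t *: ej - (x + (s * t) *: ei) = t *: ej.
  by rewrite addrC addKr.
rewrite /= dd => K; rewrite expr2 -mulrA [t * (t * _)]mulrC -mulrBl normrM.
rewrite (gtr0_norm t0) mulrA ler_pM2r//.
apply: le_trans (K _) _.
  split; rewrite /= mx_norm_ball /ball_ /=.
    by have := near_x s 1 s01 (i01 _ erefl); rewrite mul1r => /le_lt_trans; exact.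
  have := near_x s 0 s01 (o01 _ erefl).
  by rewrite mul0r scale0r addr0 => /le_lt_trans; exact.
rewrite ler_pM2l// normrZ gtr0_norm// -[leRHS]mulr1 ler_pM2l//.
exact: norm_ebasis_le.
Qed.

(** The mixed second difference is symmetric in [i] and [j], and divided by [t ^+ 2] it approximates
    both iterated partial derivatives. *)
Lemma second_partials_sym (n : nat) (f : 'rV[R]_n -> R) (x : 'rV[R]_n) (i j : 'I_n) :
  (\forall y \near x, forall i, derivable f y (ebasis R i)) ->
  (forall i, \forall y \near x, forall j,
     derivable ('D_(ebasis R i) f) y (ebasis R j)) ->
  (forall i j, {for x, continuous ('D_(ebasis R j) ('D_(ebasis R i) f))}) ->
  'D_(ebasis R j) ('D_(ebasis R i) f) x = 'D_(ebasis R i) ('D_(ebasis R j) f) x.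
Proof.
move=> df ddf cf; apply/subr0_eq/normr0_eq0/eqP; rewrite eq_le normr_ge0 andbT.
apply/ler_addgt0Pr => e e0; rewrite add0r; have e20 : 0 < e / 2 by rewrite divr_gt0.
have [d1 d10 H1] := second_difference j df (ddf i) (cf i) e20.
have [d2 d20 H2] := second_difference i df (ddf j) (cf j) e20.
pose t := Num.min d1 d2 / 2.
have m0 : 0 < Num.min d1 d2 by rewrite lt_min d10.
have t0 : 0 < t by rewrite divr_gt0.
have : t < Num.min d1 d2 by rewrite ltr_pdivrMr// ltr_pMr// ltr1n.
rewrite lt_min => /andP[t1 t2].
have {}H1 := H1 t; have {}H2 := H2 t; move: H1 H2.
rewrite t0 t1 t2 => /(_ isT) H1 /(_ isT).
rewrite [x + t *: ebasis R j + t *: ebasis R i]addrAC => H2.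
have t20 : 0 < t ^+ 2 by rewrite exprn_gt0.
rewrite -(ler_pM2l t20) -[t ^+ 2 in leLHS](gtr0_norm t20) -normrM mulrBr.
have comb (p q r s y z c : R) : `|p - q - (r - s) - y| <= c ->
    `|p - r - (q - s) - z| <= c -> `|y - z| <= c + c.
  move=> h1 h2; rewrite (_ : y - z = (p - r - (q - s) - z) - (p - q - (r - s) - y)).
    by rewrite (le_trans (ler_normB _ _))// lerD.
  by ring.
by rewrite (le_trans (comb _ _ _ _ _ _ _ H1 H2))// -mulrDl -splitr mulrC.
Qed.

End StrictDifferentiability.

(** * Tangent cones, regular normals and the polarity between them *)

Section Cones.
Variable R : realType.

Lemma cvg_dotv {T : Type} {F : set_system T} {FF : Filter F} (n : nat)
    (a b : T -> 'rV[R]_n) (a0 b0 : 'rV[R]_n) :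
  a @ F --> a0 -> b @ F --> b0 -> (fun t => dotv (a t) (b t)) @ F --> dotv a0 b0.
Proof. by move=> Aa Bb; exact: ((cvg_mxP _ _).1 (cvg_mulmx Aa (cvg_trmx Bb)) 0 0). Qed.

Lemma cvg_le_inv_succ (V : normedModType R) (w : nat -> V) (w0 : V) :
  (forall k, `|w k - w0| < k.+1%:R^-1) -> w @ \oo --> w0.
Proof.
move=> H; apply/cvgrPdist_lt => e e0.
have /cvgrPdist_lt/(_ _ e0) := @cvg_harmonic R; apply: filterS => k.
by rewrite /harmonic /= sub0r normrN ger0_norm// => /(lt_trans (H k)); rewrite distrC.
Qed.

Lemma tangent_cone_eps (n : nat) (S : set 'rV[R]_n) (x w : 'rV[R]_n) :
  (forall e : R, 0 < e ->
    exists t w', [/\ 0 < t < e, `|w' - w| < e & S (x + t *: w')]) ->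
  tangent_cone S x w.
Proof.
move=> H.
have /choice[p Hp] (k : nat) : exists p : R * 'rV[R]_n, [/\ 0 < p.1 < k.+1%:R^-1,
    `|p.2 - w| < k.+1%:R^-1 & S (x + p.1 *: p.2)].
  by have [|t [w' ?]] := H k.+1%:R^-1; [rewrite invr_gt0|exists (t, w')].
exists (fun k => (p k).1), (fun k => (p k).2); split.
- by move=> k; have [/andP[]] := Hp k.
- apply: cvg_le_inv_succ => k; have [/andP[p0 p1] _ _] := Hp k.
  by rewrite subr0 gtr0_norm.
- by apply: cvg_le_inv_succ => k; have [] := Hp k.
- by move=> k; have [] := Hp k.
Qed.

(** The definition of the cone asks for membership at every index, whereas the constructions below
    yield it only for large ones. *)
Lemma tangent_cone_eventually (n : nat) (S : set 'rV[R]_n) (x w : 'rV[R]_n)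
    (t : nat -> R) (wk : nat -> 'rV[R]_n) :
  (forall k, 0 < t k) -> t @ \oo --> 0 -> wk @ \oo --> w ->
  (\forall k \near \oo, S (x + t k *: wk k)) -> tangent_cone S x w.
Proof.
move=> t0 tc wc ev; apply: tangent_cone_eps => e e0.
have : \forall k \near \oo, [/\ t k < e, `|wk k - w| < e & S (x + t k *: wk k)].
  near=> k; split; last by near: k.
    have : `|0 - t k| < e by near: k; move/cvgrPdist_lt: tc; exact.
    by rewrite sub0r normrN gtr0_norm.
  by rewrite distrC; near: k; move/cvgrPdist_lt: wc; exact.
by move=> /filter_ex[k [tk wwk ?]]; exists (t k), (wk k); rewrite t0.
Unshelve. all: by end_near. Qed.

Lemma tangent_cone_local (n : nat) (S S' : set 'rV[R]_n) (x w : 'rV[R]_n) :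
  (\forall y \near x, S y -> S' y) -> tangent_cone S x w -> tangent_cone S' x w.
Proof.
move=> loc [t [wk [t0 tc wc SS]]]; apply: (tangent_cone_eventually t0 tc wc).
near=> k; have := SS k; near: k.
exact: (cvg_tangent (x := x) tc wc loc).
Unshelve. all: by end_near. Qed.

Lemma dotvZr (n : nat) (a b : 'rV[R]_n) (t : R) : dotv a (t *: b) = t * dotv a b.
Proof. by rewrite /dotv linearZ -scalemxAr mxE. Qed.

Lemma dotvNr (n : nat) (a b : 'rV[R]_n) : dotv a (- b) = - dotv a b.
Proof. by rewrite -scaleN1r dotvZr mulN1r. Qed.

Lemma dotv_mulmxr (m n : nat) (a : 'rV[R]_n) (l : 'rV[R]_m) (A : 'M[R]_(m, n)) :
  dotv a (l *m A) = dotv (a *m A^T) l.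
Proof. by rewrite /dotv trmx_mul mulmxA. Qed.

Lemma dotvC (n : nat) (a b : 'rV[R]_n) : dotv a b = dotv b a.
Proof. by rewrite !dotvE; apply: eq_bigr => i _; rewrite mulrC. Qed.

Lemma dotv_row_mx (n p : nat) (a c : 'rV[R]_n) (b d : 'rV[R]_p) :
  dotv (row_mx a b) (row_mx c d) = dotv a c + dotv b d.
Proof. by rewrite /dotv tr_row_mx mul_row_col mxE. Qed.

(** Dividing the defining inequality by [t k] and passing to the limit gives [dotv v w <= e * |w|]
    for every positive [e]. *)
Lemma regular_normal_le0 (n : nat) (S : set 'rV[R]_n) (x v w : 'rV[R]_n) :
  regular_normal S x v -> tangent_cone S x w -> dotv v w <= 0.
Proof.
move=> [Sx rn] [t [wk [t0 tc wc SS]]].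
suff H e : 0 < e -> dotv v w - e * `|w| <= 0.
  apply/ler_addgt0Pr => e e0; rewrite add0r.
  have w1 : 0 < `|w| + 1 by rewrite ltr_wpDl.
  have := H (e / (`|w| + 1)) (divr_gt0 e0 w1); rewrite subr_le0 => /le_trans; apply.
  by rewrite mulrAC ler_pdivrMr// ler_pM2l// lerDl.
move=> e0.
have C : (fun k => dotv v (wk k) - e * `|wk k|) @ \oo --> dotv v w - e * `|w|.
  apply: cvgB; first by apply: cvg_dotv => //; exact: cvg_cst.
  by apply: cvgM; [exact: cvg_cst|exact: cvg_norm].
apply: (cvgr_to_le C); near=> k.
have : dotv v (x + t k *: wk k - x) <= e * `|x + t k *: wk k - x|.
  have := SS k; near: k.
  exact: (cvg_tangent (x := x) tc wc (rn e e0)).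
rewrite [x + _]addrC addrK dotvZr normrZ (gtr0_norm (t0 k)) mulrCA ler_pM2l//.
by rewrite subr_le0.
Unshelve. all: by end_near. Qed.

Lemma unit_ball_compact (n : nat) : compact [set w : 'rV[R]_n | `|w| <= 1].
Proof.
have -> : [set w : 'rV[R]_n | `|w| <= 1] =
    [set w | forall i, `[(-1), 1]%classic (w ord0 i)].
  apply/seteqP; split=> w /=.
    by move=> w1 i; rewrite in_itv /= -ler_norml (le_trans (mx_entry_le_norm _ _ _)).
  move=> w1; apply/mx_norm_le => // i j; rewrite (ord1 i) ler_norml.
  by have := w1 j; rewrite in_itv.
apply: (@rV_compact _ _ (fun=> `[(-1 : R), 1]%classic)) => i.
exact: segment_compact.
Qed.

(** If the bound failed for some [e], points of [S] tending to [x] would violate it. Their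
    normalised directions cluster, by compactness, at a tangent vector [w0] with
    [dotv v w0 >= e]. *)
Lemma regular_normal_polar (n : nat) (S : set 'rV[R]_n) (x v : 'rV[R]_n) :
  S x -> (forall w, tangent_cone S x w -> dotv v w <= 0) -> regular_normal S x v.
Proof.
move=> Sx vT; split=> // e e0; apply: contrapT => nH.
have /choice[y Hy] (k : nat) : exists y, [/\ `|y - x| < k.+1%:R^-1, S y &
    e * `|y - x| < dotv v (y - x)].
  apply: contrapT => nE; apply: nH; apply/nbhs_ballP.
  exists k.+1%:R^-1; first by rewrite /= invr_gt0.
  move=> y; rewrite mx_norm_ball /ball_ /= distrC => yx Sy.
  by rewrite leNgt; apply/negP => H; apply: nE; exists y.
pose t k := `|y k - x|; pose w k := (t k)^-1 *: (y k - x).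
have t0 k : 0 < t k.
  rewrite lt_neqAle normr_ge0 andbT eq_sym normr_eq0.
  apply/eqP => yx; have [_ _] := Hy k.
  by rewrite yx normr0 /dotv trmx0 mulmx0 mxE mulr0 ltxx.
have w1 k : `|w k| = 1.
  by rewrite normrZ gtr0_norm ?invr_gt0// mulVf// gt_eqF.
have yE k : y k = x + t k *: w k.
  by rewrite /w scalerA divff ?gt_eqF// scale1r addrC subrK.
have vw k : e < dotv v (w k).
  rewrite dotvZr ltr_pdivlMl ?t0// mulrC.
  by have [] := Hy k.
have [|w0 [_ clw]] := @unit_ball_compact n (w @ \oo) _.
  by exists 0%N => // k _ /=; rewrite w1.
(* Instead of extracting a convergent subsequence, an arbitrarily late index with [w k] near the
   cluster point is chosen whenever one is called for. *)
have meet (A : set 'rV[R]_n) (k0 : nat) : nbhs w0 A -> exists2 k, (k0 <= k)%N & A (w k).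
  move=> nA; have [] := clw (w @` [set k | (k0 <= k)%N]) A _ nA.
    by exists k0 => // k /= k0k; exists k.
  by move=> _ [[k k0k <-] Aw]; exists k.
have /vT : tangent_cone S x w0.
  apply: tangent_cone_eps => d d0.
  have /cvgrPdist_lt/(_ _ d0)[k0 _ Hk0] := @cvg_harmonic R.
  have [|k k0k wk] := meet [set z | `|z - w0| < d] k0.
    by apply/nbhs_ballP; exists d => // z; rewrite mx_norm_ball /ball_ /= distrC.
  exists (t k), (w k); split=> //; last by rewrite -yE; have [] := Hy k.
  rewrite t0 /=; have := Hk0 _ k0k; rewrite /harmonic /= sub0r normrN ger0_norm//.
  by apply: lt_trans; have [] := Hy k.
apply/negP; rewrite -ltNge (lt_le_trans e0)// leNgt; apply/negP => vw0.
have C : dotv v z @[z --> w0] --> dotv v w0.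
  by apply: (@cvg_dotv _ _ (nbhs_filter w0)); [exact: cvg_cst|exact: cvg_id].
have [|k _ /=] := meet [set z | dotv v z < e] 0%N.
  exact: (@cvgr_lt _ _ _ (nbhs_filter w0) _ _ C _ vw0).
by rewrite ltNge ltW.
Qed.

End Cones.

(** Brings the completeness and the norm of matrices together, as Banach's fixed point theorem
    requires. *)
HB.instance Definition _ (R : realType) (m n : nat) := Complete.on 'M[R]_(m, n).

(** * Kernel vectors of the derivative are tangent to a regular level set *)

Section TangentLevelSet.
Variable R : realType.

Lemma ball_contraction_fixpoint (m : nat) (r : R) (g : 'rV[R]_m -> 'rV[R]_m) :
  0 <= r -> (forall s, `|s| <= r -> `|g s| <= r) ->
  (forall s s', `|s| <= r -> `|s'| <= r -> `|g s - g s'| <= 2^-1 * `|s - s'|) ->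
  exists2 s, `|s| <= r & s = g s.
Proof.
move=> r0 gr gc; pose U := [set s : 'rV[R]_m | `|s| <= r].
have gU : {homo g : s / U s >-> U s} by move=> s; exact: gr.
have half0 : 0 <= 2^-1 :> R by rewrite invr_ge0.
have [|||s] := @banach_fixed_point R _ U (mkfun gU).
- exists (NngNum half0); split=> /=; first by rewrite invf_lt1// ltr1n.
  by move=> [s s'] [/= sU s'U]; exact: gc.
- have -> : U = (fun s => `|s|) @^-1` [set y | y <= r] by [].
  apply: closed_comp; last exact: closed_le.
  by move=> s _; exact: norm_continuous.
- by exists 0; rewrite /U /= normr0.
by exists s.
Qed.

(* Lyusternik's theorem: [s |-> s - F (x + t w + s P)] contracts the ball of
   radius [o(t)], and its fixed point is the correction that brings
   [x + t w] back to the level set. *)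
Lemma level_set_tangent (n m : nat) (F : 'rV[R]_n -> 'rV[R]_m) (x w : 'rV[R]_n)
    (A : 'M[R]_(n, m)) (P : 'M[R]_(m, n)) :
  strict_diff F x A -> P *m A = 1%:M -> F x = 0 -> w *m A = 0 ->
  tangent_cone [set y | F y = 0] x w.
Proof.
move=> dF PA Fx wA; apply: tangent_cone_eps => e e0.
(* [C] bounds the linear map [s |-> s *m P]; the added [1] makes it positive. *)
pose C := m%:R * `|P| + 1.
have C0 : 0 < C by rewrite ltr_wpDl// mulr_ge0.
have sP (s : 'rV[R]_m) : `|s *m P| <= C * `|s|.
  rewrite (le_trans (norm_mulmx_le _ _))// mulrAC ler_wpM2r// /C.
  by rewrite lerDl.
(* A correction [s *m P] with [|s| <= e1 * t] has norm at most [e / 2 * t], so it turns the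
   direction [w] by less than [e]. *)
pose e1 := e / (2 * C).
have e10 : 0 < e1 by rewrite divr_gt0// mulr_gt0.
have Ce1 : C * e1 = e / 2 by rewrite /e1; field; rewrite gt_eqF.
pose W := `|w| + 1.
have W0 : 0 < W by rewrite ltr_wpDl.
(* The first bound makes [g] below a contraction of ratio one half; the second puts [g 0] within
   half of the radius [r = e1 * t]. *)
pose eta := Num.min (2 * C)^-1 (e1 / (2 * W)).
have eta0 : 0 < eta by rewrite lt_min invr_gt0 !mulr_gt0//= invr_gt0 mulr_gt0.
have l2 : (1 : R) <= 2 by rewrite ler1n.
have etaC : eta * C <= 2^-1.
  apply: (@le_trans _ _ ((2 * C)^-1 * C)).
    by rewrite ler_pM2r// ge_min lexx.
  by rewrite invfM -mulrA mulVf ?mulr1// gt_eqF.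
have etaW : eta * `|w| <= e1 / 2.
  apply: (@le_trans _ _ (e1 / (2 * W) * W)).
    by rewrite ler_pM ?(ltW eta0)// ?ge_min ?lexx ?orbT// /W lerDl.
  by rewrite invfM mulrA -mulrA mulVf ?mulr1// gt_eqF.
have [d d0 H] := strict_diff_ball dF eta0.
have We : 0 < W + e by rewrite addr_gt0.
(* The bound [t * (W + e) < d] keeps all corrected points in the ball where the strict estimate
   holds. *)
pose t := Num.min e (d / (W + e)) / 2.
have m0 : 0 < Num.min e (d / (W + e)) by rewrite lt_min e0 divr_gt0.
have t0 : 0 < t by rewrite divr_gt0.
have : t < Num.min e (d / (W + e)) by rewrite ltr_pdivrMr// ltr_pMr// ltr1n.
rewrite lt_min ltr_pdivlMr// => /andP[te td].
pose r := e1 * t.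
have r0 : 0 < r by rewrite mulr_gt0.
pose g (s : 'rV[R]_m) := s - F (x + t *: w + s *m P).
have in_ball (s : 'rV[R]_m) : `|s| <= r -> `|x + t *: w + s *m P - x| < d.
  move=> sr; have -> : x + t *: w + s *m P - x = t *: w + s *m P.
    by rewrite -(addrA x) [x + _]addrC addrK.
  rewrite (le_lt_trans (ler_normD _ _))//.
  rewrite (le_lt_trans _ td)// mulrDr lerD//.
    by rewrite normrZ gtr0_norm// ler_pM2l// /W lerDl.
  rewrite (le_trans (sP s))// (le_trans (_ : _ <= C * r)) ?ler_pM2l//.
  by rewrite /r mulrA Ce1 mulrC ler_pM2l// ler_pdivrMr// ler_pMr.
have gc (s s' : 'rV[R]_m) : `|s| <= r -> `|s'| <= r ->
    `|g s - g s'| <= 2^-1 * `|s - s'|.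
  move=> sr s'r; have := H _ _ (in_ball _ sr) (in_ball _ s'r).
  have -> : x + t *: w + s *m P - (x + t *: w + s' *m P) = (s - s') *m P.
    by rewrite opprD addrACA subrr add0r mulmxBl.
  rewrite -mulmxA PA mulmx1 => h.
  have -> : g s - g s' =
      - (F (x + t *: w + s *m P) - F (x + t *: w + s' *m P) - (s - s')).
    by rewrite /g; move: (F _) (F _) => a b; rewrite !opprB addrACA [RHS]addrACA
      (addrC (- s')).
  rewrite normrN (le_trans h)// (le_trans (_ : _ <= eta * (C * `|s - s'|)))//.
    by rewrite ler_pM2l.
  by rewrite mulrA ler_wpM2r.
have g0 : `|g 0| <= r / 2.
  have := H (x + t *: w) x; rewrite subrr normr0 => /(_ _ d0).
  have -> : x + t *: w - x = t *: w by rewrite addrC addKr.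
  rewrite -scalemxAl wA scaler0 Fx !subr0 => h.
  rewrite /g mul0mx addr0 sub0r normrN (le_trans (h _))//.
    have := in_ball 0; rewrite mul0mx addr0 addrC addKr; apply.
    by rewrite normr0 ltW.
  by rewrite normrZ (gtr0_norm t0) mulrCA /r [e1 * t / 2]mulrAC [t * _]mulrC ler_pM2r.
have gr (s : 'rV[R]_m) : `|s| <= r -> `|g s| <= r.
  move=> sr; rewrite -[g s](subrK (g 0)) (le_trans (ler_normD _ _))//.
  rewrite [r]splitr; apply: lerD => //.
  have := gc s 0 sr; rewrite normr0 => /(_ (ltW r0)) /le_trans; apply.
  by rewrite subr0 mulrC ler_pM2r// invr_gt0.
have [s sr sg] := ball_contraction_fixpoint (ltW r0) gr gc.
exists t, (w + t^-1 *: (s *m P)); split.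
- by rewrite t0.
- rewrite addrC addKr normrZ gtr0_norm ?invr_gt0// ltr_pdivrMl//.
  rewrite (le_lt_trans (sP s))// (le_lt_trans (_ : _ <= C * r)) ?ler_pM2l//.
  by rewrite /r mulrA Ce1 mulrC ltr_pM2l// ltr_pdivrMr// ltr_pMr// ltr1n.
rewrite /= scalerDr scalerA divff ?gt_eqF// scale1r addrA.
by have /(congr1 (fun z => s - z)) := sg; rewrite subrr subKr.
Qed.

End TangentLevelSet.

(** * Orthogonality and row spaces *)

Section LinearAlgebra.
Variable R : realType.

(** The columns of [cokermx A] are killed by [A], so the hypothesis gives [y *m cokermx A = 0],
    which characterises membership in the row space. *)
Lemma row_space_orthogonal (m n : nat) (A : 'M[R]_(m, n)) (y : 'rV[R]_n) :
  (forall q : 'rV[R]_n, q *m A^T = 0 -> dotv y q = 0) ->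
  exists l : 'rV[R]_m, y = l *m A.
Proof.
move=> H; apply/submxP; rewrite submxE; apply/eqP/rowP => j.
have /H : row j (cokermx A)^T *m A^T = 0.
  by rewrite -row_mul -trmx_mul mulmx_coker trmx0 row0.
by rewrite dotvE !mxE => E; rewrite -[RHS]E; apply: eq_bigr => i _; rewrite !mxE.
Qed.

Lemma dotv_le0_eq0 (n : nat) (a : 'rV[R]_n) :
  (forall b, dotv a b <= 0) -> a = 0.
Proof.
move=> H; apply/rowP => i; apply/eqP; rewrite mxE eq_le.
have E : dotv a (ebasis R i) = a 0 i.
  rewrite dotvE (bigD1 i)//= big1 ?addr0 => [|k ki].
    by rewrite !mxE !eqxx mulr1.
  by rewrite !mxE (negbTE ki) andbF mulr0.
have := H (ebasis R i); have := H (- ebasis R i).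
by rewrite dotvNr E oppr_le0 => -> ->.
Qed.

End LinearAlgebra.

(** * The manifold as a level set: Jacobian, Hessians, tangent and normal spaces *)

Section LevelSet.
Variables (R : realType) (n m : nat) (M O : set 'rV[R]_n) (h : 'I_m -> 'rV[R]_n -> R).
Hypotheses (Oopen : open O) (hC2 : forall k, C2_on O (h k)).
Hypothesis MO : M `&` O = [set x | O x /\ forall k, h k x = 0].

Definition jac (x : 'rV[R]_n) : 'M[R]_(m, n) := \matrix_(k < m) grad (h k) x.

Definition level (x : 'rV[R]_n) : 'rV[R]_m := \row_k h k x.

Definition hess_part (k : 'I_m) (x : 'rV[R]_n) : 'M[R]_n :=
  \matrix_i grad ('D_(ebasis R i) (h k)) x.

Definition lagrangian_hess (l : 'rV[R]_m) (x : 'rV[R]_n) : 'M[R]_n :=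
  \sum_k l 0 k *: hess_part k x.

Lemma near_O x : O x -> \forall y \near x, O y.
Proof. by move=> Ox; apply: open_nbhs_nbhs; split. Qed.

Lemma near_derivable x k : O x -> \forall y \near x, forall i,
  derivable (h k) y (ebasis R i).
Proof.
move=> /near_O; apply: filterS => y Oy i.
by have [_ [+ _]] := hC2 k Oy; move=> /(_ i)[].
Qed.

Lemma near_derivable2 x k i : O x -> \forall y \near x, forall j,
  derivable ('D_(ebasis R i) (h k)) y (ebasis R j).
Proof.
move=> /near_O; apply: filterS => y Oy j.
by have [_ [_]] := hC2 k Oy; move=> /(_ i j)[].
Qed.

Lemma continuous_partial x k i : O x -> {for x, continuous ('D_(ebasis R i) (h k))}.
Proof. by move=> Ox; have [_ [+ _]] := hC2 k Ox; move=> /(_ i)[]. Qed.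

Lemma continuous_partial2 x k i j : O x ->
  {for x, continuous ('D_(ebasis R j) ('D_(ebasis R i) (h k)))}.
Proof. by move=> Ox; have [_ [_]] := hC2 k Ox; move=> /(_ i j)[]. Qed.

Lemma level_strict_diff x : O x -> strict_diff level x (jac x)^T.
Proof.
move=> Ox; have E k : (fun y => level y 0 k) = h k.
  by apply/funext => y; rewrite mxE.
have -> : jac x = \matrix_k grad (fun y => level y 0 k) x.
  by apply/matrixP => k i; rewrite !mxE E.
apply: C1_strict_diff_vec => k; rewrite E; first exact: near_derivable.
by move=> i; exact: continuous_partial.
Qed.

Lemma grad_strict_diff x k : O x -> strict_diff (grad (h k)) x (hess_part k x)^T.
Proof.
move=> Ox; have E i : (fun y => grad (h k) y 0 i) = 'D_(ebasis R i) (h k).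
  by apply/funext => y; rewrite mxE.
have -> : hess_part k x = \matrix_i grad (fun y => grad (h k) y 0 i) x.
  by apply/matrixP => i j; rewrite !mxE E.
apply: C1_strict_diff_vec => i; rewrite E; first exact: near_derivable2.
by move=> j; exact: continuous_partial2.
Qed.

Lemma hess_part_sym x k : O x -> (hess_part k x)^T = hess_part k x.
Proof.
move=> Ox; apply/matrixP => i j; rewrite !mxE; apply: second_partials_sym.
- exact: near_derivable.
- by move=> i'; exact: near_derivable2.
- by move=> i' j'; exact: continuous_partial2.
Qed.

Lemma lagrangian_hess_sym l x : O x -> (lagrangian_hess l x)^T = lagrangian_hess l x.
Proof.
move=> Ox; rewrite /lagrangian_hess raddf_sum; apply: eq_bigr => k _ /=.
by rewrite linearZ /= hess_part_sym.
Qed.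

Lemma cvg_jac (xk : nat -> 'rV[R]_n) x :
  O x -> xk @ \oo --> x -> (fun k => jac (xk k)) @ \oo --> jac x.
Proof.
move=> Ox xc; apply/cvg_mxP => i j; rewrite !mxE.
under eq_fun do rewrite !mxE.
have C := @continuous_partial x i j Ox.
exact: (@continuous_cvg _ _ _ \oo _ xk ('D_(ebasis R j) (h i)) x C xc).
Qed.

Lemma cvg_lagrangian_hess (lk : nat -> 'rV[R]_m) (xk : nat -> 'rV[R]_n) l x :
  O x -> lk @ \oo --> l -> xk @ \oo --> x ->
  (fun k => lagrangian_hess (lk k) (xk k)) @ \oo --> lagrangian_hess l x.
Proof.
move=> Ox /cvg_mxP lc xc; apply: cvg_big; first exact: add_continuous.
move=> k _; apply: cvgZ; first exact: lc.
apply/cvg_mxP => i j; rewrite !mxE; under eq_fun do rewrite !mxE.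
have C := @continuous_partial2 x k i j Ox.
exact: (@continuous_cvg _ _ _ \oo _ xk ('D_(ebasis R j) ('D_(ebasis R i) (h k))) x C xc).
Qed.

(** With [l] fixed, [l *m jac] is a linear combination of the strictly differentiable gradients;
    symmetry of the Hessians removes the transpose. *)
Lemma cvg_jac_quotient (t : nat -> R) (wk : nat -> 'rV[R]_n) (w : 'rV[R]_n) l x :
  O x -> (forall k, 0 < t k) -> t @ \oo --> 0 -> wk @ \oo --> w ->
  (fun k => (t k)^-1 *: (l *m jac (x + t k *: wk k) - l *m jac x)) @ \oo -->
  w *m lagrangian_hess l x.
Proof.
move=> Ox t0 tc wc.
have -> : (fun k => (t k)^-1 *: (l *m jac (x + t k *: wk k) - l *m jac x)) =
   (fun k => \sum_i l 0 i *: ((t k)^-1 *: (grad (h i) (x + t k *: wk k) - grad (h i) x))).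
  apply/funext => k; rewrite !mulmx_sum_row -sumrB scaler_sumr.
  by apply: eq_bigr => i _; rewrite !rowK -scalerBr !scalerA mulrC.
rewrite -(lagrangian_hess_sym _ Ox) /lagrangian_hess raddf_sum mulmx_sumr.
apply: cvg_big; first exact: add_continuous.
move=> i _; rewrite /= linearZ /= -scalemxAr; apply: cvgZ; first exact: cvg_cst.
exact: strict_diff_seq (grad_strict_diff i Ox) t0 tc wc.
Qed.

Lemma memM x : O x -> M x <-> level x = 0.
Proof.
move=> Ox; have [MOx OMx] : (M x /\ O x -> O x /\ forall k, h k x = 0) /\
    (O x /\ (forall k, h k x = 0) -> M x /\ O x).
  by have /(congr1 (@^~ x)) := MO; rewrite /setI /mkset /= => ->.
split=> [Mx|/rowP Lx].
  by apply/rowP => k; rewrite !mxE; have [_] := MOx (conj Mx Ox); exact.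
by apply: (OMx _).1; split=> // k; have := Lx k; rewrite !mxE.
Qed.

Lemma tangent_level_ker x w : O x -> M x -> tangent_cone M x w -> w *m (jac x)^T = 0.
Proof.
move=> Ox Mx [t [wk [t0 tc wc SS]]].
have C := strict_diff_seq (level_strict_diff Ox) t0 tc wc.
have Z : (fun=> 0) @ \oo --> w *m (jac x)^T.
  apply: cvg_trans C; apply: near_eq_cvg; near=> k.
  have Oxk : O (x + t k *: wk k).
    by near: k; exact: (cvg_tangent (x := x) tc wc (near_O Ox)).
  by rewrite (memM Ox).1// ((memM Oxk).1 (SS k)) subrr scaler0.
by apply: (cvg_unique _ Z (cvg_cst 0)); exact: norm_hausdorff.
Unshelve. all: by end_near. Qed.

(** Lyusternik's theorem for [level], with [B^T] as the one-sided inverse of the derivative. *)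
Lemma ker_tangent_level x w (B : 'M[R]_(n, m)) : O x -> M x -> jac x *m B = 1%:M ->
  w *m (jac x)^T = 0 -> tangent_cone M x w.
Proof.
move=> Ox Mx JB wJ; apply: (tangent_cone_local (S := [set y | level y = 0])).
  by move: (near_O Ox); apply: filterS => y Oy /(memM Oy).
apply: (level_set_tangent (P := B^T)) wJ; first exact: level_strict_diff.
  by rewrite -trmx_mul JB trmx1.
exact/memM.
Qed.

Lemma row_space_normal x l : O x -> M x -> normal_map M x (l *m jac x).
Proof.
move=> Ox Mx; split=> // w /(tangent_level_ker Ox Mx) wJ.
by rewrite dotvC dotv_mulmxr wJ /dotv mul0mx mxE.
Qed.

Lemma normal_row_space x y (B : 'M[R]_(n, m)) : O x -> jac x *m B = 1%:M ->
  normal_map M x y -> exists l, y = l *m jac x.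
Proof.
move=> Ox JB [Mx yT]; apply: row_space_orthogonal => q qJ.
by apply: yT; exact: ker_tangent_level JB qJ.
Qed.


(* The projection onto [ker (jac x)], along the range of [B]; it depends
   continuously on [x] wherever [jac x *m B] is invertible. *)
Definition ker_proj (B : 'M[R]_(n, m)) (x q : 'rV[R]_n) : 'rV[R]_n :=
  q - q *m (jac x)^T *m (B *m invmx (jac x *m B))^T.

Lemma ker_proj_ker B x q : jac x *m B \in unitmx -> ker_proj B x q *m (jac x)^T = 0.
Proof.
move=> U; rewrite /ker_proj mulmxBl -[X in _ - X]mulmxA -trmx_mul.
by rewrite mulmxA mulmxV// trmx1 mulmx1 subrr.
Qed.

(** * Right inverses, kernel projections and multipliers along a sequence tending to [x] *)

Section Sequences.
Variables (B : 'M[R]_(n, m)) (x : 'rV[R]_n) (xk : nat -> 'rV[R]_n).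
Hypotheses (Ox : O x) (JB : jac x *m B = 1%:M) (xc : xk @ \oo --> x).

Lemma cvg_jacB : (fun k => jac (xk k) *m B) @ \oo --> (1%:M : 'M[R]_m).
Proof. by rewrite -JB; apply: cvg_mulmx; [exact: cvg_jac|exact: cvg_cst]. Qed.

Lemma near_jacB_unit : \forall k \near \oo, jac (xk k) *m B \in unitmx.
Proof. exact: cvg_unitmx cvg_jacB (unitmx1 _ _). Qed.

(** The matrix here is a right inverse of [jac (xk k)] as soon as [jac (xk k) *m B] is
    invertible. *)
Lemma cvg_right_inverse :
  (fun k => B *m invmx (jac (xk k) *m B)) @ \oo --> B.
Proof.
rewrite -[X in _ --> X]mulmx1 -[X in B *m X]invmx1.
by apply: cvg_mulmx; [exact: cvg_cst|apply: cvg_invmx; [exact: cvg_jacB|exact: unitmx1]].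
Qed.

Lemma cvg_ker_proj q : q *m (jac x)^T = 0 ->
  (fun k => ker_proj B (xk k) q) @ \oo --> q.
Proof.
move=> qJ; rewrite -[X in _ --> X]subr0 -(mul0mx _ B^T) -qJ.
apply: cvgB; first exact: cvg_cst.
apply: cvg_mulmx; last exact: cvg_trmx cvg_right_inverse.
by apply: cvg_mulmx; [exact: cvg_cst|apply: cvg_trmx; exact: cvg_jac].
Qed.

(** A right inverse of the Jacobian recovers the multiplier from the normal vector by a formula
    continuous in both, so multipliers converge when the normals do. *)
Lemma near_normal_multiplier (yk : nat -> 'rV[R]_n) :
  (forall k, normal_map M (xk k) (yk k)) -> \forall k \near \oo,
  yk k = (yk k *m (B *m invmx (jac (xk k) *m B))) *m jac (xk k).
Proof.
move=> yN; near=> k.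
have U : jac (xk k) *m B \in unitmx by near: k; exact: near_jacB_unit.
have Oxk : O (xk k) by near: k; exact: (xc (near_O Ox)).
have JBk : jac (xk k) *m (B *m invmx (jac (xk k) *m B)) = 1%:M.
  by rewrite mulmxA mulmxV.
have [l E] := normal_row_space Oxk JBk (yN k).
by rewrite E -(mulmxA l) JBk mulmx1.
Unshelve. all: by end_near. Qed.

End Sequences.

(** Along points of [M] approaching [x] in direction [w], let the multiplier move as
    [l + t k *: mu]; the change of the Jacobian then produces the Hessian term. *)
Lemma graph_tangent_sup (B : 'M[R]_(n, m)) x (l mu : 'rV[R]_m) (w : 'rV[R]_n) :
  O x -> M x -> jac x *m B = 1%:M -> w *m (jac x)^T = 0 ->
  tangent_cone (gph (normal_map M)) (row_mx x (l *m jac x))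
    (row_mx w (w *m lagrangian_hess l x + mu *m jac x)).
Proof.
move=> Ox Mx JB wJ.
have [t [wk [t0 tc wc SS]]] := ker_tangent_level Ox Mx JB wJ.
have xc := cvg_tangent (x := x) tc wc.
(* The increment from [l *m jac x] to [(l + t k *: mu) *m jac (x + t k *: wk k)], divided by
   [t k]. *)
pose zk k := (t k)^-1 *: (l *m jac (x + t k *: wk k) - l *m jac x)
  + mu *m jac (x + t k *: wk k).
have zc : zk @ \oo --> w *m lagrangian_hess l x + mu *m jac x.
  apply: cvgD; first exact: cvg_jac_quotient.
  by apply: cvg_mulmx; [exact: cvg_cst|exact: cvg_jac].
apply: (@tangent_cone_eventually _ _ _ _ _ t (fun k => row_mx (wk k) (zk k))) => //.
  exact/cvg_row_mx.
near=> k.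
have Oxk : O (x + t k *: wk k) by near: k; exact: (xc _ (near_O Ox)).
exists (x + t k *: wk k), ((l + t k *: mu) *m jac (x + t k *: wk k)); split.
  rewrite scale_row_mx add_row_mx; congr row_mx.
  rewrite /zk scalerDr scalerA divff ?gt_eqF// scale1r addrA.
  by rewrite [l *m jac x + _]addrC subrK mulmxDl scalemxAl.
exact: row_space_normal Oxk (SS k).
Unshelve. all: by end_near. Qed.

(** Removing the Hessian quotient from [b k] leaves a vector in the row space of the Jacobian at the
    nearby point, orthogonal to the projected [q]. In the limit [z - w *m lagrangian_hess l x] is
    orthogonal to the kernel, with no need for the multiplier quotients to converge. *)
Lemma graph_tangent_sub (B : 'M[R]_(n, m)) x (l : 'rV[R]_m) (w z : 'rV[R]_n) :
  O x -> M x -> jac x *m B = 1%:M ->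
  tangent_cone (gph (normal_map M)) (row_mx x (l *m jac x)) (row_mx w z) ->
  w *m (jac x)^T = 0 /\ exists mu, z = w *m lagrangian_hess l x + mu *m jac x.
Proof.
move=> Ox Mx JB [t [wk [t0 tc]]].
pose a k := lsubmx (wk k); pose b k := rsubmx (wk k).
have -> : wk = (fun k => row_mx (a k) (b k)) by apply/funext => k; rewrite hsubmxK.
move=> /cvg_row_mx[ac bc] SS.
have {}SS k : normal_map M (x + t k *: a k) (l *m jac x + t k *: b k).
  have [x' [y' [+ Ny]]] := SS k.
  by rewrite scale_row_mx add_row_mx => /eq_row_mx[-> ->].
have xc := cvg_tangent (x := x) tc ac.
split.
  apply: (tangent_level_ker Ox Mx); exists t, a; split=> // k.
  by have [] := SS k.
suff [mu E] : exists mu, z - w *m lagrangian_hess l x = mu *m jac x.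
  by exists mu; rewrite -E [RHS]addrC subrK.
apply: row_space_orthogonal => q qJ.
pose xk k := x + t k *: a k.
have C : (fun k => dotv (b k - (t k)^-1 *: (l *m jac (xk k) - l *m jac x))
    (ker_proj B (xk k) q)) @ \oo --> dotv (z - w *m lagrangian_hess l x) q.
  apply: cvg_dotv; last exact: (cvg_ker_proj Ox JB xc qJ).
  by apply: cvgB => //; exact: cvg_jac_quotient.
have Z : (fun=> 0) @ \oo --> dotv (z - w *m lagrangian_hess l x) q.
  apply: cvg_trans C; apply: near_eq_cvg; near=> k.
  have U : jac (xk k) *m B \in unitmx by near: k; exact: (near_jacB_unit Ox JB xc).
  have E : l *m jac x + t k *: b k = ((l *m jac x + t k *: b k) *m
      (B *m invmx (jac (xk k) *m B))) *m jac (xk k).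
    by near: k; exact: (near_normal_multiplier Ox JB xc SS).
  set l' := _ *m (B *m _) in E.
  have -> : b k - (t k)^-1 *: (l *m jac (xk k) - l *m jac x) =
      ((t k)^-1 *: (l' - l)) *m jac (xk k).
    rewrite -scalemxAl mulmxBl -E -[b k in LHS]scale1r -(@mulVf _ (t k)) ?gt_eqF//.
    rewrite -scalerA -scalerBr; congr (_ *: _).
    by rewrite opprB addrA [t k *: b k + _]addrC.
  by rewrite dotvC dotv_mulmxr ker_proj_ker// /dotv mul0mx mxE.
by apply: (cvg_unique _ Z (cvg_cst 0)) => //; exact: norm_hausdorff.
Unshelve. all: by end_near. Qed.

(** Each tangent vector considered at the base point is a limit of tangent vectors at the nearby
    points: project [w] to the kernel there, take the multipliers [lk], and keep [mu]. The
    inequality for regular normals passes to the limit. *)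
Lemma limiting_normal_graph_sub (B : 'M[R]_(n, m)) x (l mu : 'rV[R]_m)
    (p q w : 'rV[R]_n) :
  O x -> jac x *m B = 1%:M -> w *m (jac x)^T = 0 ->
  limiting_normal (gph (normal_map M)) (row_mx x (l *m jac x)) (row_mx p q) ->
  dotv p w + dotv q (w *m lagrangian_hess l x + mu *m jac x) <= 0.
Proof.
move=> Ox JB wJ [_ [yk [vk [yc vc SS RN]]]].
pose a k := lsubmx (yk k); pose b k := rsubmx (yk k).
have yE : yk = (fun k => row_mx (a k) (b k)) by apply/funext => k; rewrite hsubmxK.
pose p' k := lsubmx (vk k); pose q' k := rsubmx (vk k).
have vE : vk = (fun k => row_mx (p' k) (q' k)) by apply/funext => k; rewrite hsubmxK.
move: yc vc SS RN; rewrite yE vE => /cvg_row_mx[ac bc] /cvg_row_mx[pc qc] SS RN.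
have {}SS k : normal_map M (a k) (b k).
  by have [x' [y' [/eq_row_mx[-> ->]]]] := SS k.
pose lk k := b k *m (B *m invmx (jac (a k) *m B)).
have lc : lk @ \oo --> l.
  rewrite -[l]mulmx1 -JB mulmxA; apply: cvg_mulmx => //.
  exact: (cvg_right_inverse Ox JB ac).
pose wk k := ker_proj B (a k) w.
have wc : wk @ \oo --> w by exact: (cvg_ker_proj Ox JB ac wJ).
have C : (fun k => dotv (p' k) (wk k) + dotv (q' k)
    (wk k *m lagrangian_hess (lk k) (a k) + mu *m jac (a k))) @ \oo -->
    dotv p w + dotv q (w *m lagrangian_hess l x + mu *m jac x).
  apply: cvgD; apply: cvg_dotv => //; apply: cvgD; apply: cvg_mulmx => //.
  - exact: cvg_lagrangian_hess.
  - exact: cvg_cst.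
  - exact: cvg_jac.
apply: (cvgr_to_le C); near=> k.
have U : jac (a k) *m B \in unitmx by near: k; exact: (near_jacB_unit Ox JB ac).
have Oak : O (a k) by near: k; exact: (ac _ (near_O Ox)).
have E : b k = lk k *m jac (a k).
  by near: k; exact: (near_normal_multiplier Ox JB ac SS).
have JBk : jac (a k) *m (B *m invmx (jac (a k) *m B)) = 1%:M.
  by rewrite mulmxA mulmxV.
rewrite -dotv_row_mx; apply: (regular_normal_le0 (RN k)).
rewrite E; apply: (graph_tangent_sup _ _ Oak _ JBk); first by have [] := SS k.
exact: ker_proj_ker.
Unshelve. all: by end_near. Qed.

End LevelSet.

(** * The two inclusions, from the tangent subspace and its polar *)

Theorem theorem6p1 (R : realType) (n : nat) (M : set 'rV[R]_n) (u v : 'rV[R]_n) :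
  M u -> C2_manifold_around M u -> normal_map M u v ->
  graph_deriv (normal_map M) u v = coderiv (normal_map M) u v.
Proof.
move=> Mu [m [h [D [Oopen Ou hC2 /row_freeP[B JB] MO]]]] Nv.
have [l vE] := normal_row_space Oopen hC2 MO Ou JB Nv.
have Hsym := lagrangian_hess_sym Oopen hC2 l Ou.
set H := lagrangian_hess h l u in Hsym.
have dotvH (a b : 'rV[R]_n) : dotv a (b *m H) = dotv (a *m H) b.
  by rewrite dotv_mulmxr Hsym.
have dotvDl (a b c : 'rV[R]_n) : dotv (a + b) c = dotv a c + dotv b c.
  by rewrite /dotv mulmxDl mxE.
have dotvDr (a b c : 'rV[R]_n) : dotv a (b + c) = dotv a b + dotv a c.
  by rewrite dotvC dotvDl ![dotv _ a]dotvC.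
have dotvNl (a c : 'rV[R]_n) : dotv (- a) c = - dotv a c.
  by rewrite dotvC dotvNr dotvC.
have ker_orth (a : 'rV[R]_n) mu : a *m (jac h u)^T = 0 -> dotv a (mu *m jac h u) = 0.
  by move=> aJ; rewrite dotv_mulmxr aJ /dotv mul0mx mxE.
apply/funext => w; apply/seteqP; split=> z; rewrite /graph_deriv /coderiv /= vE.
  move=> /(graph_tangent_sub Oopen hC2 MO Ou Mu JB)[wJ [mu ->]].
  have gu : gph (normal_map M) (row_mx u (l *m jac h u)).
    by exists u, (l *m jac h u); rewrite -vE.
  (* The vector is already a regular normal at the base point, so constant sequences serve. *)
  split=> //; exists (fun=> row_mx u (l *m jac h u)).
  exists (fun=> row_mx (w *m H + mu *m jac h u) (- w)).
  split=> //; [exact: cvg_cst|exact: cvg_cst|move=> _].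
  apply: regular_normal_polar => // d; rewrite -[d]hsubmxK.
  move=> /(graph_tangent_sub Oopen hC2 MO Ou Mu JB)[dJ [nu ->]].
  (* The Hessian terms cancel by symmetry of [H]; the multiplier terms vanish because [w] and the
     first half of [d] lie in the kernel. *)
  rewrite dotv_row_mx dotvDl dotvNl dotvDr dotvH (ker_orth w)//.
  by rewrite [dotv (mu *m _) _]dotvC ker_orth// !addr0 subrr.
move=> LN.
have key (d : 'rV[R]_n) mu : d *m (jac h u)^T = 0 ->
    dotv z d - dotv w (d *m H + mu *m jac h u) <= 0.
  move=> dJ; rewrite -dotvNl.
  exact: (limiting_normal_graph_sub Oopen hC2 MO mu Ou JB dJ LN).
have wJ : w *m (jac h u)^T = 0.
  (* At [d = 0] only the multiplier term survives, and [mu] is arbitrary. *)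
  apply: dotv_le0_eq0 => mu; have := key 0 (- mu) (mul0mx _ _).
  rewrite mul0mx add0r mulNmx dotvNr opprK dotv_mulmxr.
  by rewrite /dotv trmx0 mulmx0 mxE add0r.
suff [mu E] : exists mu, z - w *m H = mu *m jac h u.
  rewrite -[z](subrK (w *m H)) E addrC.
  exact: (graph_tangent_sup Oopen hC2 MO _ _ Ou Mu JB wJ).
apply: row_space_orthogonal => q qJ.
(* Here [mu = 0]. Since the kernel contains [- q] along with [q], the inequality becomes an
   equality. *)
have le0 (d : 'rV[R]_n) : d *m (jac h u)^T = 0 -> dotv (z - w *m H) d <= 0.
  move=> dJ; have := key d 0 dJ.
  by rewrite mul0mx addr0 dotvH dotvDl dotvNl.
apply/eqP; rewrite eq_le le0//= -oppr_le0 -dotvNr le0//.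
by rewrite mulNmx qJ oppr0.
Qed.
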